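(* There is no finite non-commutative inverse semigroup whose commuting graph has clique number equal to $1$.
   Context: A semigroup $S$ is an inverse semigroup if it is equipped with a unary operation $x\mapsto x^{-1}$ such that for all $x,y\in S$: $(x^{-1})^{-1}=x$, $xx^{-1}x=x$, $(xy)^{-1}=y^{-1}x^{-1}$, and $(xx^{-1})(yy^{-1})=(yy^{-1})(xx^{-1})$. Equivalently, every $x\in S$ has a unique inverse, i.e. a unique $y\in S$ with $xyx=x$ and $yxy=y$. The center of $S$ is $Z(S)=\{x\in S: xy=yx \text{ for all } y\in S\}$. The commuting graph of a finite non-commutative semigroup $S$ is the simple graph with vertex set $S\setminus Z(S)$ in which two distinct vertices $x,y$ are adjacent if and only if $xy=yx$. The clique number of a finite simple graph is the maximum size of a set of pairwise adjacent vertices. *)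

(* Defs.v *)
From HB Require Import structures.
From mathcomp Require Import all_boot.

Set Implicit Arguments.
Unset Strict Implicit.
Unset Printing Implicit Defensive.

Local Open Scope group_scope.

#[short(type="finSemigroupType")]
HB.structure Definition FinSemigroup := {S of Semigroup S & Finite S}.

(* A property of the semigroup: the unary operation is existentially quantified.
   The library's notation _^-1 is not available, since it is tied to
   structures with a unit. *)
Definition inverse_semigroup (S : semigroupType) : Prop :=
  exists inv : S -> S,
    [/\ forall x, inv (inv x) = x,
        forall x, x * inv x * x = x,
        forall x y, inv (x * y) = inv y * inv x
      & forall x y, (x * inv x) * (y * inv y) = (y * inv y) * (x * inv x)].

Definition scenter (S : finSemigroupType) : {set S} :=
  [set x | [forall y : S, x * y == y * x]].

Record sgraph := SGraph {
  vertex :> finType;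
  adj : rel vertex;
  adj_sym : symmetric adj;
  adj_irrefl : irreflexive adj
}.

Definition clique (G : sgraph) (A : {set G}) : bool :=
  [forall x in A, forall y in A, (x != y) ==> adj x y].

Definition clique_number (G : sgraph) : nat :=
  \max_(A : {set G} | clique A) #|A|.

Section CommutingGraph.

Variable S : finSemigroupType.

Definition noncentral : finType := {x : S | x \notin scenter S}.

Definition commuting_adj : rel noncentral :=
  fun x y => (x != y) && (val x * val y == val y * val x).

Lemma commuting_adj_sym : symmetric commuting_adj.
Proof. by move=> x y; rewrite /commuting_adj eq_sym [X in _ && X]eq_sym. Qed.

Lemma commuting_adj_irrefl : irreflexive commuting_adj.
Proof. by move=> x; rewrite /commuting_adj eqxx. Qed.

Definition commuting_graph : sgraph :=
  SGraph commuting_adj_sym commuting_adj_irrefl.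

End CommutingGraph.

(* Main.v *)
Require Import Defs.
From HB Require Import structures.
From mathcomp Require Import all_boot.

(** Clique number 1 means that two commuting noncentral elements are equal.
    Applied to [y] and [y * y], and to pairs of commuting idempotents, this
    forces every idempotent to be central.  Then [x] commutes with its inverse,
    so every noncentral [x] is its own inverse.  If [x] and [y] do not commute,
    [x * y] is noncentral too, hence [x * y = inv (x * y) = inv y * inv x = y * x]. *)

Local Open Scope group_scope.

Lemma scenterP (S : finSemigroupType) (x : S) :
  reflect (forall y, x * y = y * x) (x \in scenter S).
Proof. by rewrite inE; apply: (iffP forallP) => cx y; apply/eqP. Qed.

(** Two distinct commuting noncentral elements would form a clique of size 2. *)
Lemma clique_number_le1_commute (S : finSemigroupType) :
  clique_number (commuting_graph S) <= 1 ->
  forall x y : S, x \notin scenter S -> y \notin scenter S ->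
    x * y = y * x -> x = y.
Proof.
move=> le1 x y ncx ncy cxy; apply/eqP/negPn/negP => neq_xy.
pose u : commuting_graph S := Sub x ncx; pose v : commuting_graph S := Sub y ncy.
have neq_uv : u != v by rewrite -val_eqE.
have uv_clique : clique [set u; v].
  apply/forall_inP => a /set2P Ha; apply/forall_inP => b /set2P Hb.
  apply/implyP => neq_ab; rewrite /= /commuting_adj neq_ab /=.
  by case: Ha Hb => -> [] -> /=; rewrite ?cxy eqxx.
have := leq_trans (leq_bigmax_cond (F := fun A : {set commuting_graph S} => #|A|)
  _ uv_clique) le1.
by rewrite cards2 neq_uv.
Qed.

Section InverseSemigroup.

Variables (S : finSemigroupType) (inv : S -> S).
Hypothesis invK : forall x, inv (inv x) = x.
Hypothesis mulKV : forall x, x * inv x * x = x.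
Hypothesis invM : forall x y, inv (x * y) = inv y * inv x.
Hypothesis projC : forall x y,
  (x * inv x) * (y * inv y) = (y * inv y) * (x * inv x).
Hypothesis commute_eq : forall x y : S,
  x \notin scenter S -> y \notin scenter S -> x * y = y * x -> x = y.

Lemma mulVKV x : inv x * x * inv x = inv x.
Proof. by have := mulKV (inv x); rewrite invK. Qed.

Lemma inv_scenter x : inv x \in scenter S -> x \in scenter S.
Proof.
move/scenterP=> cx; apply/scenterP => y.
by have /(congr1 inv) := cx (inv y); rewrite !invM !invK.
Qed.

(** Projections commute by [projC], so at most one of them is noncentral. *)
Lemma scenter_or_eq_proj x y :
  x * inv x \notin scenter S ->
  y * inv y \in scenter S \/ y * inv y = x * inv x.
Proof.
move=> ncx; case: (boolP (y * inv y \in _)) => [|ncy]; first by left.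
by right; apply: commute_eq.
Qed.

(** If [y] or [y * y] is central, it can be moved past the other factors. Otherwise the two commute,
    so [y = y * y], and then [y] equals the central [inv y * y], a contradiction. *)
Lemma mul_proj_of_scenter y : inv y * y \in scenter S -> y * y * inv y = y.
Proof.
move=> /[dup] Zf /scenterP cf.
have fy : inv y * y * y = y by rewrite cf mulgA mulKV.
case: (boolP (y \in scenter S)) => [/scenterP cy|ncy].
  by rewrite -mulgA cy mulKV.
case: (boolP (y * y \in scenter S)) => [/scenterP cyy|ncyy].
  by rewrite cyy mulgA fy.
have yy : y = y * y by apply: commute_eq => //; rewrite mulgA.
by case/negP: ncy; rewrite -fy -mulgA -yy.
Qed.

(** With [f = y * inv y] and [h = inv y * e * y], centrality gives [y * h = e * y] and [h = e * f];
    hence [e * y = y * e * f = f * y * e = y * e]. *)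
Lemma commute_of_conj_scenter e y :
  y * inv y \in scenter S -> inv y * e * y \in scenter S -> e * y = y * e.
Proof.
move=> /scenterP cf /scenterP ch.
have yf : y * (y * inv y) = y by rewrite -cf mulKV.
have yh : y * (inv y * e * y) = e * y by rewrite !mulgA cf -mulgA mulKV.
have hE : inv y * e * y = e * (y * inv y).
  by rewrite -[LHS]mulgA -{2}yf !mulgA ch yh -!mulgA.
by rewrite -yh hE mulgA -cf mulgA mulKV.
Qed.

Lemma proj_scenter x : x * inv x \in scenter S.
Proof.
(* If [e = x * inv x] is noncentral, then each of [y * inv y], [inv y * y] and [inv y * e * y] (the
   projection of [inv y * x]) is central or equal to [e]. Every case yields [e * y = y * e]. *)
apply/negPn/negP => ncx; case/negP: (ncx); apply/scenterP => y.
have := scenter_or_eq_proj x (inv y * x) ncx.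
have -> : inv y * x * inv (inv y * x) = inv y * (x * inv x) * y.
  by rewrite invM invK !mulgA.
have := scenter_or_eq_proj x (inv y) ncx; rewrite invK.
have [Zf|fe] := scenter_or_eq_proj x y ncx; case=> [Zg|ge].
- case=> [|he]; first exact: commute_of_conj_scenter.
  have /scenterP cf := Zf; move: (x * inv x) he => e he.
  by rewrite -[in RHS]he !mulgA cf -mulgA mulKV.
(* Here [inv y * y = e]: inverting the identity for [inv y] gives [e * y = y], and [y * e = y] is
   [mulKV]. *)
- move=> _; have := mul_proj_of_scenter (inv y).
  rewrite invK => /(_ Zf) /(congr1 inv); rewrite !invM !invK mulgA ge => ey.
  by rewrite ey -ge mulgA mulKV.
- by move=> _; rewrite -fe mulKV mulgA mul_proj_of_scenter.
- by move=> _; rewrite -[in LHS]fe mulKV -ge mulgA mulKV.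
Qed.

Lemma inv_noncentral x : x \notin scenter S -> inv x = x.
Proof.
move=> ncx; apply: commute_eq => //; first by apply: contra ncx; apply: inv_scenter.
have /scenterP ce := proj_scenter x.
have /scenterP cf := proj_scenter (inv x); rewrite invK in cf.
(* With [e = x * inv x] and [f = inv x * x] central, [f = e * f = f * e = e]. *)
have fx : inv x * x * x = x by rewrite cf mulgA mulKV.
have ex : inv x = x * inv x * inv x by rewrite ce mulgA mulVKV.
by rewrite {1}ex -mulgA -cf !mulgA fx.
Qed.

Lemma mul_comm : commutative (@mul S).
Proof.
move=> x y; change (x * y = y * x).
case: (boolP (x \in scenter S)) => [/scenterP->//|ncx].
case: (boolP (y \in scenter S)) => [/scenterP->//|ncy].
have [ix iy] := (inv_noncentral x ncx, inv_noncentral y ncy).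
case: (boolP (x * y \in scenter S)) => [/scenterP cxy|ncxy].
  (* Both [x * y] and [x * x] are central and [x = x * x * x], so [xy = xx(xy) = x(xy)x = (xx)yx =
     y(xx)x = yx]. *)
  have /scenterP := proj_scenter x; rewrite ix => cxx.
  have := mulKV x; rewrite ix => xxx.
  by rewrite -{1}xxx -!mulgA -cxy !mulgA cxx -!mulgA [x * (x * x)]mulgA xxx.
by rewrite -(inv_noncentral _ ncxy) invM ix iy.
Qed.

End InverseSemigroup.

Theorem theorem4p6 :
  ~ exists S : finSemigroupType,
      [/\ inverse_semigroup S,
          ~ commutative (@mul S)
        & clique_number (commuting_graph S) = 1%N].
Proof.
move=> [S [[inv [invK mulKV invM projC]] ncS cl1]]; apply: ncS.
apply: (mul_comm S inv) => //; apply: clique_number_le1_commute.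
by rewrite cl1.
Qed.
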